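(* Let $\mathcal{F}$ be the class of compact flowers in $\mathbb{R}^n$ containing the origin in their interior, and let $B_2^n$ be the closed Euclidean unit ball. There exist maps $F\mapsto F^{\lambda}$ from $\mathcal{F}$ to $\mathcal{F}$, one for each $0\le\lambda<\infty$, with the following properties: (1) $F^{1}=F$ and $F^{0}=B_2^n$ for all $F\in\mathcal{F}$. (2) If $F_1\subseteq F_2$ then $F_1^{\lambda}\subseteq F_2^{\lambda}$. (3) $(tF)^{\lambda}=t^{\lambda}F^{\lambda}$ for $t>0$. (4) $F^{\lambda}$ is continuous with respect to both $F$ and $\lambda$: if $F_i\to F$ and $\lambda_i\to\lambda$ then $F_i^{\lambda_i}\to F^{\lambda}$. (5) $(F^{\mu})^{\lambda}=F^{\lambda\mu}$ whenever $0<\lambda,\mu\le1$, and whenever $1\le\lambda,\mu<\infty$. (6) If $aB_2^n\subseteq F\subseteq\sqrt{2}\,a\,B_2^n$ for some $a>0$, then $(F^{\lambda})^{1/\lambda}=F$ for all $0<\lambda\le1$.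
   Context: For $x\in\mathbb{R}^n$ let $B_x$ be the closed Euclidean ball with center $x/2$ and radius $|x|/2$. A flower is a set of the form $\bigcup_{x\in A}B_x$ for some $A\subseteq\mathbb{R}^n$. Here all flowers are assumed compact and to contain the origin in their interior. Convergence $F_i\to F$ of such flowers means that there is a sequence $\epsilon_i\to0$ with $(1-\epsilon_i)F\subseteq F_i\subseteq(1+\epsilon_i)F$ for all sufficiently large $i$ (this is equivalent to convergence in the Hausdorff metric). *)

(* Defs.v *)
From mathcomp Require Import all_boot all_order all_algebra.
From mathcomp Require Import all_classical all_reals all_analysis.
Set Implicit Arguments.
Unset Strict Implicit.
Unset Printing Implicit Defensive.
Import Order.TTheory GRing.Theory Num.Theory.
Import numFieldNormedType.Exports.
Local Open Scope classical_set_scope.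
Local Open Scope ring_scope.

(* The library norm on ['rV[R]_n] is the sup norm; it only provides the topology
   (the usual one of R^n), while balls are taken for the Euclidean norm. *)
Definition enorm (R : realType) (n : nat) (x : 'rV[R]_n) : R :=
  Num.sqrt (\sum_(i < n) x 0 i ^+ 2).

Definition eball (R : realType) (n : nat) (c : 'rV[R]_n) (r : R) :
    set 'rV[R]_n :=
  [set y | enorm (y - c) <= r].

Definition unit_eball (R : realType) (n : nat) : set 'rV[R]_n := eball 0 1.
Arguments unit_eball : clear implicits.

Definition petal (R : realType) (n : nat) (x : 'rV[R]_n) : set 'rV[R]_n :=
  eball (2^-1 *: x) (enorm x / 2).

Definition is_flower (R : realType) (n : nat) (F : set 'rV[R]_n) : Prop :=
  exists A : set 'rV[R]_n, F = \bigcup_(x in A) petal x.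

Definition flowers (R : realType) (n : nat) : set (set 'rV[R]_n) :=
  [set F | [/\ is_flower F, compact F & F° 0]].
Arguments flowers : clear implicits.

Definition dilate (R : realType) (n : nat) (t : R) (F : set 'rV[R]_n) :
    set 'rV[R]_n :=
  [set t *: x | x in F].

Definition flower_cvg (R : realType) (n : nat)
    (Fs : nat -> set 'rV[R]_n) (F : set 'rV[R]_n) : Prop :=
  exists2 eps : nat -> R, eps @ \oo --> (0 : R) &
    \forall i \near \oo,
      dilate (1 - eps i) F `<=` Fs i /\ Fs i `<=` dilate (1 + eps i) F.

(* Main.v *)
(** A flower F is determined by its core K = {x | B_x ⊆ F}, the convex body
    whose support function is the radial function of F; conversely F is the
    union of the petals of K.  Raising the radial function of K to a power t
    is the map (r, theta) |-> (r^t, theta), which spoils convexity.  So we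
    let K^l be the value at time l of the smallest family (X_s) of closed
    convex sets, s ranging over [0, 1] or over [1, oo), such that K ⊆ X_1 and
    X_s is sent into X_(t s) by (r, theta) |-> (r^t, theta).  Minimality gives
    the semigroup law, by concatenating families, as well as monotonicity and
    homogeneity.  If r^-1 B ⊆ K ⊆ r B, the family r^|s-1| K is admissible, so
    that l |-> K^l is Lipschitz on the logarithmic scale; together with
    monotonicity and homogeneity this yields the joint continuity.

    If a B ⊆ K ⊆ sqrt 2 a B and s <= 1, the image of K under
    (r, theta) |-> (r^s, theta) is still convex, so the minimal family consists
    of such images, and the same images run backwards show that the power 1/l
    undoes the power l. *)
Require Import Defs.
From mathcomp Require Import all_boot all_order all_algebra.
From mathcomp Require Import all_classical all_reals all_analysis.
From mathcomp Require Import ring lra.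
Set Implicit Arguments.
Unset Strict Implicit.
Unset Printing Implicit Defensive.
Import Order.TTheory GRing.Theory Num.Theory.
Import numFieldNormedType.Exports.
Local Open Scope classical_set_scope.
Local Open Scope ring_scope.

(** * Inner product, petals, dilations and the radial power map *)

Section Euclidean.
Variables (R : realType) (n : nat).
Implicit Types (x y z : 'rV[R]_n) (a c : R).

Definition dot x y : R := \sum_(i < n) x 0 i * y 0 i.

Lemma dotC x y : dot x y = dot y x.
Proof. by apply: eq_bigr => i _; rewrite mulrC. Qed.

Lemma dotDl x y z : dot (x + y) z = dot x z + dot y z.
Proof. by rewrite -big_split; apply: eq_bigr => i _; rewrite mxE mulrDl. Qed.

Lemma dotZl a x y : dot (a *: x) y = a * dot x y.
Proof. by rewrite mulr_sumr; apply: eq_bigr => i _; rewrite mxE mulrA. Qed.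

Lemma dotDr x y z : dot x (y + z) = dot x y + dot x z.
Proof. by rewrite dotC dotDl !(dotC _ x). Qed.

Lemma dotZr a x y : dot x (a *: y) = a * dot x y.
Proof. by rewrite dotC dotZl dotC. Qed.

Lemma dot0l x : dot 0 x = 0.
Proof. by rewrite -(scale0r x) dotZl mul0r. Qed.

Lemma dot0r x : dot x 0 = 0.
Proof. by rewrite dotC dot0l. Qed.

Lemma dot_ge0 x : 0 <= dot x x.
Proof. by apply: sumr_ge0 => i _; rewrite -expr2 sqr_ge0. Qed.

Lemma dot_eq0 x : (dot x x == 0) = (x == 0).
Proof.
apply/idP/eqP => [|->]; last by rewrite dot0l.
rewrite /dot psumr_eq0 => [|i _]; last by rewrite -expr2 sqr_ge0.
move=> /allP x0; apply/rowP => i; rewrite mxE; apply/eqP.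
by have := x0 i (mem_index_enum _); rewrite mulf_eq0 orbb.
Qed.

Lemma enormE x : enorm x = Num.sqrt (dot x x).
Proof. by congr Num.sqrt; apply: eq_bigr => i _; rewrite expr2. Qed.

Lemma enorm_ge0 x : 0 <= enorm x.
Proof. exact: sqrtr_ge0. Qed.

Lemma enorm_sqr x : enorm x ^+ 2 = dot x x.
Proof. by rewrite enormE sqr_sqrtr ?dot_ge0. Qed.

Lemma enorm0 : enorm (0 : 'rV[R]_n) = 0.
Proof. by rewrite enormE dot0l sqrtr0. Qed.

Lemma enorm_eq0 x : (enorm x == 0) = (x == 0).
Proof. by rewrite -dot_eq0 -enorm_sqr sqrf_eq0. Qed.

Lemma enorm_gt0 x : (0 < enorm x) = (x != 0).
Proof. by rewrite lt_neqAle enorm_ge0 andbT eq_sym enorm_eq0. Qed.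

Lemma enormZ a x : enorm (a *: x) = `|a| * enorm x.
Proof.
by rewrite !enormE dotZl dotZr mulrA -expr2 sqrtrM ?sqr_ge0// sqrtr_sqr.
Qed.

Lemma enorm_le x a : 0 <= a -> (enorm x <= a) = (dot x x <= a ^+ 2).
Proof. by move=> a0; rewrite -enorm_sqr ler_sqr ?nnegrE ?enorm_ge0. Qed.

Lemma sqr_dot_le x y : dot x y ^+ 2 <= dot x x * dot y y.
Proof.
have [->|y0] := eqVneq y 0; first by rewrite !dot0r mulr0 expr0n.
have yy : 0 < dot y y by rewrite lt_neqAle dot_ge0 andbT eq_sym dot_eq0.
(* The squared norm of this vector is |y|^2 times the difference of the two sides. *)
have := dot_ge0 (dot y y *: x + (- dot x y) *: y).
rewrite !(dotDl, dotDr, dotZl, dotZr) (dotC y x) => h.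
by rewrite -subr_ge0 -(pmulr_rge0 _ yy); nra.
Qed.

Lemma dot_le_enorm x y : dot x y <= enorm x * enorm y.
Proof.
apply: le_trans (ler_norm _) _; rewrite -ler_sqr ?nnegrE ?mulr_ge0 ?enorm_ge0//.
by rewrite real_normK ?num_real// exprMn !enorm_sqr sqr_dot_le.
Qed.

Lemma eball0E x a : 0 <= a -> eball 0 a x <-> dot x x <= a ^+ 2.
Proof. by move=> a0; rewrite /eball /= subr0 enorm_le. Qed.

(** The petal is the ball with diameter [0, x]: expanding |y - x/2|^2 <= |x|^2/4 cancels |x|^2/4,
    which leaves a condition linear in x. *)
Lemma petalE x y : petal x y <-> dot y y <= dot x y.
Proof.
rewrite /petal /eball /= enorm_le ?divr_ge0 ?enorm_ge0// exprMn enorm_sqr.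
rewrite -scaleN1r !(dotDl, dotDr, dotZl, dotZr) (dotC y x).
by split; nra.
Qed.

Lemma petal_self x : petal x x.
Proof. exact/petalE. Qed.

Lemma petal_le_enorm x y : petal x y -> enorm y <= enorm x.
Proof.
move=> /petalE h; have [->|y0] := eqVneq y 0; first by rewrite enorm0 enorm_ge0.
rewrite -(@ler_pM2r _ (enorm y)) ?enorm_gt0// -expr2 enorm_sqr.
exact: le_trans h (dot_le_enorm _ _).
Qed.

Lemma dilateE c (A : set 'rV[R]_n) x : c != 0 ->
  dilate c A x <-> A (c^-1 *: x).
Proof.
move=> c0; split=> [[y Ay <-]|Ax]; first by rewrite scalerA mulVf// scale1r.
by exists (c^-1 *: x) => //; rewrite scalerA mulfV// scale1r.
Qed.

Lemma dilate_mono c (A B : set 'rV[R]_n) :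
  A `<=` B -> dilate c A `<=` dilate c B.
Proof. by move=> AB _ [x Ax <-]; exists x => //; exact: AB. Qed.

Lemma dilate_comp a c (A : set 'rV[R]_n) :
  dilate a (dilate c A) = dilate (a * c) A.
Proof.
rewrite /dilate image_comp; apply: eq_imagel => x _ /=.
by rewrite scalerA.
Qed.

Lemma dilate1 (A : set 'rV[R]_n) : dilate 1 A = A.
Proof. by rewrite /dilate (eq_imagel (fun x _ => scale1r x)) image_id. Qed.

Lemma dilate_petal c x : dilate c (petal x) `<=` petal (c *: x).
Proof.
move=> _ [y /petalE xy <-]; apply/petalE.
by rewrite !(dotZl, dotZr) !mulrA ler_wpM2l // -expr2 sqr_ge0.
Qed.

Lemma dilate_unit_eball a : 0 < a -> dilate a (unit_eball R n) = eball 0 a.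
Proof.
move=> a0; apply/seteqP; split => [_ [y + <-]|x].
  rewrite /unit_eball /eball /= !subr0 => y1.
  by rewrite enormZ gtr0_norm// ler_piMr// ltW.
rewrite /eball /= subr0 => xa; apply/dilateE; first by rewrite gt_eqF.
rewrite /unit_eball /eball /= subr0 enormZ gtr0_norm ?invr_gt0//.
by rewrite mulrC ler_pdivrMr// mul1r.
Qed.

(* [vpow t] maps the point with polar coordinates (r, theta) to (r^t, theta). *)
Definition vpow (t : R) x : 'rV[R]_n := enorm x `^ (t - 1) *: x.

Lemma vpow0r t : vpow t 0 = 0.
Proof. by rewrite /vpow scaler0. Qed.

Lemma vpow1 x : vpow 1 x = x.
Proof. by rewrite /vpow subrr powRr0 scale1r. Qed.

Lemma enorm_vpow t x : x != 0 -> enorm (vpow t x) = enorm x `^ t.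
Proof.
move=> x0; rewrite enormZ ger0_norm ?powR_ge0//.
rewrite -[X in _ * X]powRr1 ?enorm_ge0// -powRD ?subrK//.
by rewrite enorm_eq0 x0 implybT.
Qed.

Lemma enorm_vpow_le t x : enorm (vpow t x) <= enorm x `^ t.
Proof.
have [->|x0] := eqVneq x 0; first by rewrite vpow0r enorm0 powR_ge0.
by rewrite enorm_vpow.
Qed.

Lemma vpow_comp s t x : vpow t (vpow s x) = vpow (t * s) x.
Proof.
have [->|x0] := eqVneq x 0; first by rewrite !vpow0r.
rewrite {1}/vpow enorm_vpow// /vpow scalerA -powRrM -powRD; last first.
  by rewrite enorm_eq0 x0 implybT.
by congr (_ `^ _ *: _); ring.
Qed.

Lemma vpowZ t c x : 0 < c -> vpow t (c *: x) = c `^ t *: vpow t x.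
Proof.
move=> c0; rewrite /vpow enormZ gtr0_norm// powRM ?enorm_ge0 ?(ltW c0)//.
rewrite !scalerA; congr (_ *: _).
rewrite mulrAC -[X in _ * X * _]powRr1 ?(ltW c0)//.
rewrite -powRD ?subrK//.
by rewrite (gt_eqF c0) implybT.
Qed.

End Euclidean.

(** * The correspondence between flowers and their convex cores *)

Section Cores.
Variables (R : realType) (n : nat).
Implicit Types (x y u : 'rV[R]_n) (K F : set 'rV[R]_n) (a c r : R).

(** Closed convexity in dual form, as an intersection of closed half-spaces, so that separating a
    point from [K] is immediate. *)
Definition hull_closed K := forall x,
  (forall u c, (forall y, K y -> dot u y <= c) -> dot u x <= c) -> K x.

Lemma hull_closed_eball r : 0 <= r -> hull_closed (eball 0 r).
Proof.
move=> r0 x /(_ x (enorm x * r)) h; apply/eball0E => //.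
rewrite -enorm_le//; have [->|x0] := eqVneq x 0; first by rewrite enorm0.
have x_gt0 : 0 < enorm x by rewrite enorm_gt0.
rewrite -(ler_pM2l x_gt0) -expr2 enorm_sqr; apply: h => y /eball0E yr.
apply: le_trans (dot_le_enorm _ _) _.
by rewrite ler_pM2l// enorm_le// yr.
Qed.

Lemma hull_closed_dilate c K : 0 < c -> hull_closed K ->
  hull_closed (dilate c K).
Proof.
move=> c0 hK x hx; apply/dilateE; first by rewrite gt_eqF.
apply: hK => u d hd; rewrite dotZr mulrC ler_pdivrMr//.
apply: hx => _ [y Ky <-]; rewrite dotZr mulrC.
by rewrite ler_pM2r// hd.
Qed.

Lemma hull_closed_shrink a K x : hull_closed K -> K 0 -> K x ->
  0 <= a <= 1 -> K (a *: x).
Proof.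
move=> hK K0 Kx /andP[a0 a1]; apply: hK => u c hc; rewrite dotZr.
have := hc _ K0; rewrite dot0r => c0; apply: (@le_trans _ _ (a * c)).
  by rewrite ler_wpM2l// hc.
by rewrite ler_piMl.
Qed.

Definition core F : set 'rV[R]_n := [set x | petal x `<=` F].

Definition flower K : set 'rV[R]_n := \bigcup_(x in K) petal x.

Lemma core_mono F1 F2 : F1 `<=` F2 -> core F1 `<=` core F2.
Proof. by move=> h x hx y /hx /h. Qed.

Lemma flower_mono K1 K2 : K1 `<=` K2 -> flower K1 `<=` flower K2.
Proof. by move=> h y [x /h]; exists x. Qed.

Lemma sub_flower K : K `<=` flower K.
Proof. by move=> x Kx; exists x => //; exact: petal_self. Qed.

Lemma core_sub F : core F `<=` F.
Proof. by move=> x; apply; exact: petal_self. Qed.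

Lemma flower_core F : is_flower F -> flower (core F) = F.
Proof.
move=> [A ->]; apply/seteqP; split=> [y [x]|y [x Ax xy]]; first exact.
by exists x => // z xz; exists x.
Qed.

(** If <u, x> > 0, the foot [t *: u] of the perpendicular from [x] to the line of [u] lies in the
    petal of [x], hence in the petal of some [k] in [K]. This says <u, k> >= <u, x>, so no
    half-space containing [K] excludes [x]. *)
Lemma core_flower K : hull_closed K -> K 0 -> core (flower K) = K.
Proof.
move=> hK K0; apply/seteqP; split=> [x hx|x Kx]; last first.
  by move=> y xy; exists x.
apply: hK => u c hc; have [ux|ux] := leP (dot u x) 0.
  by rewrite (le_trans ux)// -(dot0r u) hc.
have uu : 0 < dot u u.
  rewrite lt_neqAle dot_ge0 andbT eq_sym dot_eq0.
  by apply: contraTneq ux => ->; rewrite dot0l ltxx.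
pose t := dot u x / dot u u.
have t0 : 0 < t by rewrite divr_gt0.
have tuu : t * dot u u = dot u x by rewrite /t divfK// gt_eqF.
have [|k Kk /petalE] := hx (t *: u).
  by apply/petalE; rewrite !(dotZl, dotZr) tuu (dotC x).
rewrite !(dotZl, dotZr) tuu ler_pM2l// (dotC k) => h.
exact: le_trans h (hc _ Kk).
Qed.

Lemma dilate_flower c K : 0 < c -> flower (dilate c K) = dilate c (flower K).
Proof.
move=> c0; have c_neq0 : c != 0 by rewrite gt_eqF.
apply/seteqP; split=> [y [x /dilateE - /(_ c_neq0) Kx xy]|_ [y [x Kx xy] <-]].
  apply/dilateE => //; exists (c^-1 *: x) => //.
  by apply: dilate_petal; exists y.
by exists (c *: x); [exists x|apply: dilate_petal; exists y].
Qed.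

Lemma dilate_core c F : 0 < c -> core (dilate c F) = dilate c (core F).
Proof.
move=> c0; have c_neq0 : c != 0 by rewrite gt_eqF.
apply/seteqP; split=> [x hx|_ [x hx <-] y xy].
  apply/dilateE => // y xy; have [|z Fz] := hx (c *: y).
    rewrite -[x in petal x]scale1r -(mulfV c_neq0) -scalerA.
    by apply: dilate_petal; exists y.
  by move=> /(scalerI c_neq0) <-.
apply/dilateE => //; apply: hx.
rewrite -[x]scale1r -(mulVf c_neq0) -scalerA.
by apply: dilate_petal; exists y.
Qed.

(** A single [r] controls both inclusions: the power s replaces [r] with r^s, and errors are
    measured by dilation factors that are powers of [r]. *)
Definition body r K :=
  [/\ 1 <= r, hull_closed K, eball 0 r^-1 `<=` K & K `<=` eball 0 r].

Lemma body0 r K : body r K -> K 0.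
Proof.
move=> [r1 _ + _]; apply; apply/eball0E; last by rewrite dot0l sqr_ge0.
by rewrite invr_ge0 (le_trans _ r1).
Qed.

End Cores.

(** * Minimal evolutions and their algebra *)

Section PowersOfCores.
Variables (R : realType) (n : nat).
Implicit Types (x y u : 'rV[R]_n) (K : set 'rV[R]_n) (l m s t r : R) (b : bool).

(** The Boolean selects one of the two ranges of exponents, each closed under multiplication. *)
Definition side b s := if b then 0 <= s <= 1 else 1 <= s.

Lemma side1 b : side b 1.
Proof. by case: b; rewrite /side ?lexx ?ler01. Qed.

Lemma side_ge0 b s : side b s -> 0 <= s.
Proof. by case: b => [/andP[]//|]; exact: le_trans ler01. Qed.

Lemma side_mul b s t : side b s -> side b t -> side b (t * s).
Proof.
case: b => /= [/andP[s0 s1] /andP[t0 t1]|s1 t1]; last by rewrite mulr_ege1.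
by rewrite mulr_ge0//= mulr_ile1.
Qed.

(** In t s - 1 = t (s - 1) + (t - 1) both summands have the same sign. This additivity is what makes
    r^|s-1| K an evolution. *)
Lemma side_dist b s t : side b s -> side b t ->
  `|t * s - 1| = t * `|s - 1| + `|t - 1|.
Proof.
move=> hs ht; have hts := side_mul hs ht; case: b hs ht hts => /=.
  move=> /andP[s0 s1] /andP[t0 t1] /andP[_ ts1].
  by rewrite !ler0_norm ?subr_le0//; ring.
by move=> s1 t1 ts1; rewrite !ger0_norm ?subr_ge0//; ring.
Qed.

Definition evolution b K (X : R -> set 'rV[R]_n) :=
  [/\ K `<=` X 1, forall s, side b s -> hull_closed (X s)
    & forall s t x, side b s -> side b t -> X s x -> X (t * s) (vpow t x)].

Definition power b l K : set 'rV[R]_n :=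
  [set x | forall X, evolution b K X -> X l x].

Lemma power_min b l K X : evolution b K X -> power b l K `<=` X l.
Proof. by move=> hX x; apply. Qed.

(** Each clause of [evolution] survives intersection, so a least evolution exists. *)
Lemma power_evolution b K : evolution b K (fun s => power b s K).
Proof.
split=> [x Kx X [KX _ _]|s hs x hx X hX|s t x hs ht hx X hX].
- exact: KX.
- case: (hX) => _ /(_ _ hs) hXs _; apply: hXs => u c hc.
  by apply: hx => y /(_ _ hX) /hc.
- by case: (hX) => _ _; apply => //; exact: hx.
Qed.

Lemma power_hull_closed b l K : side b l -> hull_closed (power b l K).
Proof. by case: (power_evolution b K) => _ + _; apply. Qed.

Lemma power_vpow b s t K x : side b s -> side b t ->
  power b s K x -> power b (t * s) K (vpow t x).
Proof. by case: (power_evolution b K) => _ _; apply. Qed.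

Lemma vpow_power b s K x : side b s -> K x -> power b s K (vpow s x).
Proof.
move=> hs Kx; rewrite -(mulr1 s) {2}mulr1.
by apply: power_vpow (side1 b) hs _ => X [+ _ _]; apply.
Qed.

Lemma power_mono b l K1 K2 : K1 `<=` K2 -> power b l K1 `<=` power b l K2.
Proof.
move=> K12 x hx X [KX hX1 hX2]; apply: hx; split=> //.
exact: subset_trans K12 KX.
Qed.

(** If X is an evolution from K, then t^s X_s is one from t K, since [vpow v] turns the factor t^s
    into t^(v s). *)
Lemma power_dilate_sub b l t K : 0 < t ->
  power b l (dilate t K) `<=` dilate (t `^ l) (power b l K).
Proof.
move=> t0 x hx; have tp s : 0 < t `^ s by exact: powR_gt0.
have tn s : t `^ s != 0 by rewrite gt_eqF.
apply/dilateE => // X [KX hX1 hX2]; apply/dilateE => //.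
apply: (hx (fun s => dilate (t `^ s) (X s))); split => [|s hs|s v y hs hv].
- by rewrite powRr1 ?ltW//; exact: dilate_mono.
- exact/hull_closed_dilate/hX1.
- move=> [z Xz <-]; rewrite vpowZ// -powRrM (mulrC s).
  by exists (vpow v z) => //; exact: hX2.
Qed.

Lemma power_dilate b l t K : 0 < t ->
  power b l (dilate t K) = dilate (t `^ l) (power b l K).
Proof.
move=> t0; apply/seteqP; split; first exact: power_dilate_sub.
have t_neq0 : t != 0 by rewrite gt_eqF.
have h : power b l (dilate t^-1 (dilate t K)) `<=`
    dilate (t^-1 `^ l) (power b l (dilate t K)).
  by apply: power_dilate_sub; rewrite invr_gt0.
move: h; rewrite dilate_comp mulVf// dilate1 => /(@dilate_mono _ _ (t `^ l)).
by rewrite dilate_comp -powRM ?invr_ge0 ?ltW// mulfV// powR1 dilate1.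
Qed.

(* An evolution issued from [power b m K] extends the minimal evolution issued
   from K, followed up to time m. *)
Lemma power_power b l m K : side b l -> side b m -> 0 < m ->
  power b l (power b m K) = power b (l * m) K.
Proof.
move=> hl hm m0; have m_neq0 : m != 0 by rewrite gt_eqF.
apply/seteqP; split=> x hx X.
  move=> hX; have [KX hX1 hX2] := hX.
  apply: (hx (fun s => X (s * m))); split => [|s hs|s t y hs ht Xy].
  - by rewrite mul1r; exact: power_min.
  - by apply: hX1; exact: side_mul.
  - by rewrite -mulrA; apply: hX2 => //; exact: side_mul.
move=> [KX hX1 hX2].
(* For s on side [b], the quotient [s / m] is on side [b] exactly when s is at least as far from 1
   as m. So [Y] follows the minimal evolution before time m and [X] from then on. *)
pose Y s := if `[< side b (s / m) >] then X (s / m) else power b s K.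
have Ym s : side b (s / m) -> Y s = X (s / m) by move=> h; rewrite /Y asboolT.
have hYP s : side b s -> ~ side b (s / m) -> Y s = power b s K.
  by move=> _ h; rewrite /Y asboolF.
suff : Y (l * m) x by rewrite Ym mulfK.
apply: hx; split => [|s hs|s t y hs ht].
(* Time 1 comes before m, unless m = 1. *)
- have [h1|h1] := pselect (side b (1 / m)); last first.
    by rewrite hYP//; [case: (power_evolution b K)|exact: side1].
  rewrite Ym// => y Ky.
  have m1 : m = 1.
    apply/eqP; rewrite eq_le; case: (b) hm h1 => /=.
      by move=> /andP[_ ->] /andP[_]; rewrite ler_pdivrMr// mul1r.
    by move=> ->; rewrite ler_pdivlMr// mul1r andbT.
  rewrite m1 divr1; apply: KX; rewrite m1.
  by case: (power_evolution b K) => + _ _; apply.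
- have [h|h] := pselect (side b (s / m)); first by rewrite Ym//; exact: hX1.
  by rewrite hYP//; exact: power_hull_closed.
- have [h|h] := pselect (side b (s / m)).
    rewrite Ym// Ym -mulrA; last exact: side_mul.
    exact: hX2.
  rewrite hYP//; have [h'|h'] := pselect (side b (t * s / m)); last first.
    by rewrite hYP//; [exact: power_vpow|exact: side_mul].
  rewrite Ym// => Py.
  (* Here [s] comes before m and [t * s] does not. The map [vpow t] is split at time m as the power
     m / s, inside the minimal evolution, followed by the power t s / m, inside [X]. *)
  have s0 : s != 0.
    by apply/eqP => s0; move: h' h; rewrite s0 mulr0.
  have hms : side b (m / s).
    have : 0 < s by rewrite lt_neqAle eq_sym s0 (side_ge0 hs).
    case: (b) h => /= h sp.
      rewrite divr_ge0 ?(ltW m0) ?(ltW sp)//= ler_pdivrMr// mul1r leNgt.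
      apply/negP => ms.
      apply: h; rewrite divr_ge0 ?(ltW m0) ?(ltW sp)//= ler_pdivrMr//.
      by rewrite mul1r (ltW ms).
    rewrite ler_pdivlMr// mul1r leNgt; apply/negP => ms.
    by apply: h; rewrite ler_pdivlMr// mul1r (ltW ms).
  have -> : vpow t y = vpow (t * s / m) (vpow (m / s) y).
    by rewrite vpow_comp; congr vpow; field; rewrite s0.
  rewrite -[t * s / m]mulr1 {2}mulr1; apply: hX2 => //; first exact: side1.
  apply: KX; rewrite -[m in power b m K](divfK s0).
  exact: power_vpow.
Qed.

End PowersOfCores.

(** * Size estimates and Lipschitz dependence on the exponent *)

Section Bounds.
Variables (R : realType) (n : nat).
Implicit Types (x y u : 'rV[R]_n) (K : set 'rV[R]_n) (l m s t r : R) (b : bool).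

Lemma powR_le1 r s : 1 <= r -> s <= 0 -> r `^ s <= 1.
Proof. by move=> r1 s0; rewrite -(powRr0 r) ler_powR. Qed.

Lemma powR_ge1 r s : 1 <= r -> 0 <= s -> 1 <= r `^ s.
Proof. by move=> r1 s0; rewrite -(powRr0 r) ler_powR. Qed.

Lemma powR_base_le1 r s : 0 <= r <= 1 -> 0 <= s -> r `^ s <= 1.
Proof.
move=> /andP[x0 x1] s0; apply: (@le_trans _ _ (1 `^ s)); last by rewrite powR1.
by rewrite ge0_ler_powR ?nnegrE.
Qed.

Lemma eball0P r x : eball 0 r x <-> enorm x <= r.
Proof. by rewrite /eball /= subr0. Qed.

Lemma powRinv r s : 0 <= r -> r^-1 `^ s = (r `^ s)^-1.
Proof. by move=> r0; rewrite -powR_inv1// -powRrM mulN1r powRN. Qed.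

(** The sphere of radius 1/r lies in [K] and is sent onto the sphere of radius r^-s; shrinking
    towards 0 fills the inner ball. For the outer bound, the balls of radius r^s form an
    evolution. *)
Lemma body_power b s r K : body r K -> side b s ->
  body (r `^ s) (power b s K).
Proof.
move=> bK hs; have K0 := body0 bK; case: bK => r1 hK rK Kr.
have r0 : 0 < r := lt_le_trans ltr01 r1; have s0 := side_ge0 hs.
split; first exact: powR_ge1.
- exact: power_hull_closed.
- move=> y /eball0P ys; have [->|y0] := eqVneq y 0.
    by rewrite -(vpow0r n s); exact: vpow_power.
  have ey : 0 < enorm y by rewrite enorm_gt0.
  have xK : K ((r^-1 / enorm y) *: y).
    apply: rK; apply/eball0P.
    by rewrite enormZ ger0_norm ?divfK ?gt_eqF// divr_ge0 ?invr_ge0 ?ltW.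
  have := vpow_power hs xK; rewrite vpowZ ?divr_gt0 ?invr_gt0//.
  have -> : (r^-1 / enorm y) `^ s *: vpow s y = ((r `^ s)^-1 / enorm y) *: y.
    rewrite /vpow scalerA powRM ?invr_ge0 ?enorm_ge0 ?(ltW r0)//.
    rewrite !powRinv ?enorm_ge0 ?(ltW r0)// powRB ?enorm_eq0 ?y0 ?implybT//.
    rewrite powRr1 ?enorm_ge0//; congr (_ *: _).
    by field; rewrite !gt_eqF ?powR_gt0.
  move=> hP.
  have -> : y = (enorm y * r `^ s) *: (((r `^ s)^-1 / enorm y) *: y).
    rewrite scalerA; have -> : enorm y * r `^ s * ((r `^ s)^-1 / enorm y) = 1.
      by field; rewrite !gt_eqF ?powR_gt0.
    by rewrite scale1r.
  apply: hull_closed_shrink hP _; first exact: power_hull_closed.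
    by rewrite -(vpow0r n s); exact: vpow_power.
  rewrite mulr_ge0 ?enorm_ge0 ?powR_ge0//=.
  by rewrite -ler_pdivlMr ?powR_gt0// div1r.
- apply: (@power_min _ _ _ _ _ (fun s => eball 0 (r `^ s))); split.
  + by rewrite powRr1 ?ltW.
  + by move=> u _; apply: hull_closed_eball; exact: powR_ge0.
  + move=> u t x hu ht /eball0P xu; apply/eball0P.
    apply: le_trans (enorm_vpow_le _ _) _; rewrite mulrC powRrM.
    by rewrite ge0_ler_powR ?nnegrE ?enorm_ge0 ?powR_ge0 ?(side_ge0 ht).
Qed.

(** The vector is [x] times (r |x|)^(t-1) if t <= 1, and times (|x| / r)^(t-1) if t >= 1. The factor
    is at most 1 except when t < 1 and |x| < 1/r; then the vector has norm at most 1/r and lies in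
    the inner ball. *)
Lemma body_vpow b t r K x : body r K -> side b t -> K x ->
  K (r `^ (- `|t - 1|) *: vpow t x).
Proof.
move=> bK ht Kx; have K0 := body0 bK; case: bK => r1 hK rK Kr.
have r0 : 0 < r := lt_le_trans ltr01 r1.
have [->|x0] := eqVneq x 0; first by rewrite vpow0r scaler0.
have ex : 0 < enorm x by rewrite enorm_gt0.
have shrink : r `^ (- `|t - 1|) * enorm x `^ (t - 1) <= 1 ->
    K (r `^ (- `|t - 1|) *: vpow t x).
  move=> h; rewrite scalerA; apply: hull_closed_shrink => //.
  by rewrite mulr_ge0 ?powR_ge0.
case: b ht => /= [/andP[t0 t1]|t1].
  rewrite ler0_norm ?subr_le0// opprK in shrink *.
  have [rx|rx] := leP r^-1 (enorm x).
    apply: shrink; rewrite -powRM ?enorm_ge0 ?(ltW r0)//.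
    by rewrite powR_le1 ?subr_le0// mulrC -ler_pdivrMr// div1r.
  apply: rK; apply/eball0P; rewrite enormZ ger0_norm ?powR_ge0// enorm_vpow//.
  apply: (@le_trans _ _ (r `^ (t - 1) * r^-1 `^ t)).
    rewrite ler_wpM2l ?powR_ge0// ge0_ler_powR ?nnegrE ?enorm_ge0 ?invr_ge0//.
      exact: ltW.
    exact: ltW.
  rewrite powRinv ?(ltW r0)// powRB ?(gt_eqF r0) ?implybT//.
  by rewrite powRr1 ?(ltW r0)// mulrAC mulfV ?mul1r// gt_eqF ?powR_gt0.
rewrite ger0_norm ?subr_ge0// in shrink *; apply: shrink.
rewrite powRN -powRinv ?(ltW r0)// -powRM ?invr_ge0 ?enorm_ge0 ?(ltW r0)//.
rewrite powR_base_le1 ?subr_ge0//.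
rewrite mulr_ge0 ?invr_ge0 ?enorm_ge0 ?(ltW r0)//=.
by rewrite mulrC ler_pdivrMr// mul1r; apply/eball0P/Kr.
Qed.

(** Under [vpow t] the factor r^|s-1| becomes r^(t |s-1|); by [side_dist] the allowance left is
    r^|t-1|, exactly what [body_vpow] requires. *)
Lemma power_le b s r K : body r K -> side b s ->
  power b s K `<=` dilate (r `^ `|s - 1|) K.
Proof.
move=> bK hs; have [r1 hK _ _] := bK.
have r0 : 0 < r := lt_le_trans ltr01 r1.
apply: (@power_min _ _ _ _ _ (fun s => dilate (r `^ `|s - 1|) K)); split.
- by rewrite subrr normr0 powRr0 dilate1.
- by move=> u _; apply: hull_closed_dilate => //; exact: powR_gt0.
- move=> u t _ hu ht [x Kx <-]; rewrite vpowZ ?powR_gt0// (side_dist hu ht).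
  exists (r `^ (- `|t - 1|) *: vpow t x); first exact: body_vpow bK ht Kx.
  rewrite scalerA -powRrM -powRD ?(gt_eqF r0) ?implybT//.
  by rewrite addrK mulrC.
Qed.

(** The point r^-|t-1| x is a shrinking of [vpow t x], which lies in the power. The exception is t >
    1 with |x| < 1/r, where it falls into the inner ball of radius r^-t. *)
Lemma power_ge b t r K : body r K -> side b t ->
  K `<=` dilate (r `^ `|t - 1|) (power b t K).
Proof.
move=> bK ht x Kx; have bP := body_power bK ht; have P0 := body0 bP.
case: bP => _ hP rP _; case: bK => r1 hK rK Kr.
have r0 : 0 < r := lt_le_trans ltr01 r1.
apply/dilateE; first by rewrite gt_eqF ?powR_gt0.
have [->|x0] := eqVneq x 0; first by rewrite scaler0.
have ex : 0 < enorm x by rewrite enorm_gt0.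
have shrink : (r `^ `|t - 1|)^-1 * (enorm x `^ (t - 1))^-1 <= 1 ->
    power b t K ((r `^ `|t - 1|)^-1 *: x).
  move=> h; set c := r `^ _ in h *; set e := enorm x `^ _ in h.
  have -> : c^-1 *: x = (c^-1 * e^-1) *: vpow t x.
    by rewrite scalerA mulfVK ?gt_eqF ?powR_gt0.
  apply: hull_closed_shrink => //.
    exact: (vpow_power ht Kx).
  by rewrite mulr_ge0 ?invr_ge0 ?powR_ge0.
case: b ht hP rP P0 shrink => /= [/andP[t0 t1]|t1] hP rP P0 shrink.
  rewrite ler0_norm ?subr_le0// in shrink *; apply: shrink.
  rewrite -(powRN (enorm x)) -powRinv ?(ltW r0)//.
  rewrite -powRM ?invr_ge0 ?enorm_ge0 ?(ltW r0)//.
  rewrite powR_base_le1 ?oppr_ge0 ?subr_le0//.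
  rewrite mulr_ge0 ?invr_ge0 ?enorm_ge0 ?(ltW r0)//=.
  by rewrite mulrC ler_pdivrMr// mul1r; apply/eball0P/Kr.
rewrite ger0_norm ?subr_ge0// in shrink *.
have [rx|rx] := leP r^-1 (enorm x).
  apply: shrink; rewrite -invfM -powRM ?enorm_ge0 ?(ltW r0)//.
  rewrite invf_le1 ?powR_gt0 ?mulr_gt0// powR_ge1 ?subr_ge0//.
  by rewrite mulrC -ler_pdivrMr// div1r.
apply: rP; apply/eball0P; rewrite enormZ ger0_norm ?invr_ge0 ?powR_ge0//.
apply: (@le_trans _ _ ((r `^ (t - 1))^-1 * r^-1)).
  by rewrite ler_wpM2l ?invr_ge0 ?powR_ge0// ltW.
rewrite -invfM -{2}(powRr1 (ltW r0)) -powRD ?subrK//.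
by rewrite (gt_eqF r0) implybT.
Qed.

Lemma power_one b r K : body r K -> power b 1 K = K.
Proof.
move=> bK; apply/seteqP; split.
  by have := power_le bK (side1 R b); rewrite subrr normr0 powRr0 dilate1.
by case: (power_evolution b K).
Qed.

(** Of the two exponents, the one farther from 1 is reached from the other by a further power, say l
    = (l/m) m. The power m has constant r^m, and (r^m)^|l/m-1| = r^|l-m|. *)
Lemma power_lipschitz b l m r K : body r K -> side b l -> side b m ->
  power b l K `<=` dilate (r `^ `|l - m|) (power b m K).
Proof.
move=> bK hl hm; have [r1 _ _ _] := bK; have l0 := side_ge0 hl.
have r0 : 0 <= r := le_trans ler01 r1; have m0 := side_ge0 hm.
have dist (v w : R) : 0 < v -> (r `^ v) `^ `|w / v - 1| = r `^ `|w - v|.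
  move=> v0; rewrite -powRrM -[X in X * _]gtr0_norm// -normrM.
  by rewrite mulrBr mulr1 mulrC divfK// gt_eqF.
(* Both exponents may be 0 here; once they differ, the one nearer to 1 is positive and can be
   divided by. *)
have [->|lm] := eqVneq l m; first by rewrite subrr normr0 powRr0 dilate1.
have [[mp hlm]|[lp hml]] :
    0 < m /\ side b (l / m) \/ 0 < l /\ side b (m / l).
- case: b hl hm => /= [_ _|hl hm]; move: lm; case: (ltgtP l m) => // lm _.
  + have mp : 0 < m := le_lt_trans l0 lm; left; split=> //.
    by rewrite divr_ge0//= ler_pdivrMr// mul1r ltW.
  + have lp : 0 < l := le_lt_trans m0 lm; right; split=> //.
    by rewrite divr_ge0//= ler_pdivrMr// mul1r ltW.
  + have lp : 0 < l := lt_le_trans ltr01 hl; right; split=> //.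
    by rewrite ler_pdivlMr// mul1r ltW.
  + have mp : 0 < m := lt_le_trans ltr01 hm; left; split=> //.
    by rewrite ler_pdivlMr// mul1r ltW.
- have := power_le (body_power bK hm) hlm.
  by rewrite power_power// dist// divfK// gt_eqF.
- have := power_ge (body_power bK hl) hml.
  by rewrite power_power// dist// divfK ?gt_eqF// distrC.
Qed.

Definition core_power l K := power (l <= 1) l K.

Lemma side_le1 l : 0 <= l -> side (l <= 1) l.
Proof.
by move=> l0; rewrite /side; case: (leP l 1) => [_|/ltW//]; rewrite l0.
Qed.

(** The two sides overlap only at l = 1, where both powers return [K]. *)
Lemma core_powerE b l r K : body r K -> side b l ->
  core_power l K = power b l K.
Proof.
rewrite /core_power => bK; case: b => /= [/andP[_ ->]//|].
rewrite le_eqVlt => /predU1P[<-|l1]; first by rewrite !(power_one _ bK).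
by rewrite leNgt l1.
Qed.

Lemma body_core_power l r K : 0 <= l -> body r K ->
  body (r `^ l) (core_power l K).
Proof. by move=> l0 bK; apply: body_power => //; exact: side_le1. Qed.

Lemma core_power_lipschitz l m r K : 0 <= l -> 0 <= m -> body r K ->
  core_power l K `<=` dilate (r `^ `|l - m|) (core_power m K).
Proof.
move=> l0 m0 bK.
(* Exponents on opposite sides are compared through the exponent 1, and the distances add up. *)
have [h|h] : (exists2 b, side b l & side b m) \/
    `|l - m| = `|l - 1| + `|1 - m|.
- have [l1|l1] := leP l 1; have [m1|m1] := leP m 1.
  + by left; exists true; rewrite /side ?l0 ?m0.
  + right; rewrite !ler0_norm ?subr_le0//; [|lra..]; ring.
  + right; rewrite !ger0_norm ?subr_ge0//; [|lra..]; ring.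
  + by left; exists false; rewrite /side ltW.
- case: h => b hl hm.
  by rewrite (core_powerE bK hl) (core_powerE bK hm); exact: power_lipschitz.
have [r1 _ _ _] := bK; have r0 : 0 < r := lt_le_trans ltr01 r1.
rewrite h powRD ?(gt_eqF r0) ?implybT// -dilate_comp.
apply: subset_trans (power_lipschitz bK (side_le1 l0) (side1 R _)) _.
apply: dilate_mono; rewrite (power_one _ bK) -{1}(power_one (m <= 1) bK).
exact: power_lipschitz bK (side1 R _) (side_le1 m0).
Qed.

Lemma core_power_power l m r K : body r K ->
  (0 < l <= 1 /\ 0 < m <= 1) \/ (1 <= l /\ 1 <= m) ->
  core_power l (core_power m K) = core_power (l * m) K.
Proof.
move=> bK hlm; have [b [hl hm m0]] : exists b, [/\ side b l, side b m & 0 < m].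
  case: hlm => [[/andP[l0 l1] /andP[m0 m1]]|[l1 m1]].
    by exists true; rewrite /side (ltW l0) (ltW m0) l1 m1.
  by exists false; split=> //; exact: lt_le_trans m1.
rewrite (core_powerE bK hm) (core_powerE (body_power bK hm) hl).
by rewrite (core_powerE bK (side_mul hm hl)) power_power.
Qed.

End Bounds.

(** * Compactness, and the passage between flowers and bodies *)

Section Topology.
Variables (R : realType) (n : nat).
Implicit Types (x y u : 'rV[R]_n) (K F : set 'rV[R]_n) (l m s t r : R).

Lemma norm_le_enorm x : `|x| <= enorm x.
Proof.
rewrite [leLHS]/Num.Def.normr/= mx_normrE bigmax_le ?enorm_ge0//= => -[i j] _.
rewrite /=.
rewrite ord1 -ler_sqr ?nnegrE ?enorm_ge0// enorm_sqr real_normK ?num_real//.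
rewrite /dot (bigD1 j)//= -expr2 lerDl.
by apply: sumr_ge0 => k _; rewrite -expr2 sqr_ge0.
Qed.

Lemma dot_continuous u : continuous (dot u).
Proof.
apply: continuous_big => [|i _ x]; first exact: add_continuous.
apply: (@cvgM R _ (nbhs x) _ (fun=> u 0 i) (fun y => y 0 i)).
  exact: cvg_cst.
exact: coord_continuous.
Qed.

Lemma enorm_continuous : continuous (@enorm R n).
Proof.
move=> x; apply: (@continuous_comp _ _ _ (fun x => \sum_(i < n) x 0 i ^+ 2)).
  move: x; apply: continuous_big => [|i _ x]; first exact: add_continuous.
  by apply: (@cvgM R _ (nbhs x) _ (fun y => y 0 i) (fun y => y 0 i));
    exact: coord_continuous.
exact: sqrt_continuous.
Qed.

Lemma eball0_nbhs r : 0 < r -> nbhs (0 : 'rV[R]_n) (eball 0 r).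
Proof.
move=> r0; have : \forall x \near (0 : 'rV[R]_n), enorm x < r.
  apply: (@enorm_continuous 0 [set z | z < r]).
  by rewrite enorm0; exact: lt_nbhsl.
by apply: filterS => x /= /ltW; rewrite /eball /= subr0.
Qed.

Lemma sub_eball_bounded K r : K `<=` eball 0 r -> bounded_set K.
Proof.
move=> Kr; exists r; split; first exact: num_real.
move=> s rs x /Kr /eball0P xr; apply: le_trans (norm_le_enorm _) _.
exact: le_trans xr (ltW rs).
Qed.

Lemma hull_closed_closed K : hull_closed K -> closed K.
Proof.
move=> hK x clx; apply: hK => u c hc; rewrite leNgt; apply/negP => cu.
have /clx [y [/hc]] : nbhs x [set y | c < dot u y].
  apply: (@dot_continuous u x [set z | c < z]).
  exact: lt_nbhsr.
by rewrite leNgt => /negP.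
Qed.

Lemma body_compact r K : body r K -> compact K.
Proof.
move=> [_ hK _ Kr]; apply: bounded_closed_compact.
  exact: sub_eball_bounded Kr.
exact: hull_closed_closed.
Qed.

(** The flower is the image of the compact set K x B under the continuous map (x, e) |-> x/2 +
    (|x|/2) e, where B is the unit ball. *)
Lemma flower_compact r K : body r K -> compact (flower K).
Proof.
move=> bK.
have Ceb : compact (eball (0 : 'rV[R]_n) 1).
  apply: bounded_closed_compact; first exact: (@sub_eball_bounded _ 1).
  by apply: hull_closed_closed; exact: hull_closed_eball.
pose f (z : 'rV[R]_n * 'rV[R]_n) := 2^-1 *: z.1 + (enorm z.1 / 2) *: z.2.
have -> : flower K = f @` (K `*` eball 0 1).
  apply/seteqP; split=> [y [x Kx xy]|_ [[x e] [/= Kx /eball0P e1] <-]].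
    have [x0|x0] := eqVneq x 0.
      exists (x, 0); first by split=> //=; apply/eball0P; rewrite enorm0.
      move: xy => /petalE; rewrite x0 dot0l => yy.
      have /eqP : dot y y == 0 by rewrite eq_le yy dot_ge0.
      move/eqP; rewrite dot_eq0 => /eqP ->.
      by rewrite /f /= !scaler0 addr0.
    have ex : 0 < enorm x / 2 by rewrite divr_gt0 ?enorm_gt0.
    exists (x, (enorm x / 2)^-1 *: (y - 2^-1 *: x)).
      split=> //=; apply/eball0P; rewrite enormZ gtr0_norm ?invr_gt0//.
      by rewrite mulrC ler_pdivrMr// mul1r.
    by rewrite /f /= scalerA mulfV ?gt_eqF// scale1r addrC subrK.
  exists x => //; rewrite /petal /eball /= /f /= addrAC subrr add0r enormZ.
  by rewrite ger0_norm ?divr_ge0 ?enorm_ge0// ler_piMr// divr_ge0 ?enorm_ge0.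
apply: continuous_compact; last exact/compact_setX/Ceb/body_compact/bK.
apply: continuous_subspaceT => z.
have c1 : {for z, continuous (@fst 'rV[R]_n 'rV[R]_n)} by exact: cvg_fst.
have c2 : {for z, continuous (@snd 'rV[R]_n 'rV[R]_n)} by exact: cvg_snd.
have c3 : {for z, continuous (fun z : 'rV[R]_n * 'rV[R]_n => enorm z.1)}.
  by apply: continuous_comp c1 _; exact: enorm_continuous.
apply: cvgD; first exact: cvgZl_tmp c1.
by apply: cvgZ c2; apply: cvgM c3 _; exact: cvg_cst.
Qed.

Lemma flowers_flower r K : body r K -> flowers R n (flower K).
Proof.
move=> bK; split; [by exists K|exact: flower_compact bK|].
have [r1 _ rK _] := bK.
have : nbhs (0 : 'rV[R]_n) (eball 0 r^-1).
  by apply: eball0_nbhs; rewrite invr_gt0 (lt_le_trans ltr01).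
apply: filterS => x /rK; exact: sub_flower.
Qed.

(** If [y] in the petal of [x] is outside [F], so is k y for some 0 < k < 1, as [F] is closed. No
    petal of the core contains k y, so the core satisfies <z, y> <= k |y|^2. This half-space then
    contains [x], contradicting |y|^2 <= <x, y> unless y = 0. *)
Lemma hull_closed_core F : closed F -> F 0 -> hull_closed (core F).
Proof.
move=> cF F0 x hx y /petalE xy; apply: contrapT => Fy.
have nFy : nbhs y (~` F).
  by apply: open_nbhs_nbhs; split=> //; exact: closed_openC.
have : k *: y @[k --> (1 : R)^'-] --> y.
  rewrite -[y in _ --> y]scale1r; apply: cvg_at_left_filter.
  by apply: cvgZr_tmp; exact: cvg_id.
move=> /(_ _ nFy) /= h.
have [k [/= Fky k0 k1]] : exists k : R, [/\ ~ F (k *: y), 0 < k & k < 1].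
  have : \forall k \near (1 : R)^'-, [/\ ~ F (k *: y), 0 < k & k < 1].
    near=> k; split; first by near: k; exact: h.
    - by near: k; exact: nbhs_left_gt.
    - by near: k; exact: nbhs_left_lt.
  by move=> /filter_ex.
have : dot y x <= k * dot y y.
  apply: hx => z Fz; rewrite leNgt; apply/negP => zy; apply: Fky; apply: Fz.
  apply/petalE; rewrite !(dotZl, dotZr) (dotC z) ler_pM2l//.
  exact: ltW.
rewrite dotC => /(le_trans xy) yk.
have yy : dot y y <= 0 by have := dot_ge0 y; nra.
have /eqP : dot y y == 0 by rewrite eq_le yy dot_ge0.
by move/eqP; rewrite dot_eq0 => /eqP y0; apply: Fky; rewrite y0 scaler0.
Unshelve. all: by end_near. Qed.

Lemma flowers_body F : flowers R n F -> exists r, body r (core F).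
Proof.
move=> [_ cF F0]; have clF : closed F by exact: compact_closed.
have [M [_ hM]] : bounded_set (@enorm R n @` F).
  apply: compact_bounded; apply: continuous_compact cF.
  by apply: continuous_subspaceT => x; exact: enorm_continuous.
have [e /= e0 he] := (nbhs_ballP _ _).1 F0.
(* The ball of radius [e] is open and taken for the sup norm; halving the radius leaves room for a
   closed Euclidean ball. *)
have {}he : eball 0 (e / 2) `<=` F.
  move=> x /eball0P xe; apply: he; rewrite -ball_normE /= sub0r normrN.
  apply: le_lt_trans (norm_le_enorm _) _; apply: le_lt_trans xe _.
  by rewrite ltr_pdivrMr// ltr_pMr// ltr1n.
pose r := Num.max 1 (Num.max (M + 1) (e / 2)^-1).
have r1 : 1 <= r by rewrite le_max lexx.
have rM : M + 1 <= r by rewrite !le_max lexx orbT.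
have re : r^-1 <= e / 2.
  by rewrite invf_ple ?posrE ?(lt_le_trans _ r1) ?divr_gt0// !le_max lexx !orbT.
exists r; split=> //.
- by apply: hull_closed_core => //; exact: nbhs_singleton.
- move=> x /eball0P xr y xy; apply: he; apply/eball0P.
  exact: le_trans (petal_le_enorm xy) (le_trans xr re).
- move=> x Fx; apply/eball0P; apply: le_trans rM.
  have := hM (M + 1); rewrite ltrDl ltr01 => /(_ isT (enorm x)) /=.
  rewrite ger0_norm ?enorm_ge0//; apply.
  by exists x => //; exact: core_sub.
Qed.

End Topology.

(** * Real inequalities behind the ratio sqrt 2 *)

Section SqrtTwo.
Variable R : realType.
Implicit Types (m v A D N U s k : R).

(* The map t |-> ln (1 + t^2) is convex on [-1, 1] only: this is where the
   constant sqrt 2 comes from. *)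
Lemma ln_sqr_tangent m v : 0 <= m <= 1 -> 0 <= v <= 1 ->
  2 * m / (1 + m ^+ 2) * (v - m) <= ln (1 + v ^+ 2) - ln (1 + m ^+ 2).
Proof.
have p (t : R) : 0 < 1 + t ^+ 2 by rewrite ltr_wpDr ?sqr_ge0.
pose f t : R := ln (1 + t ^+ 2); pose f' t : R := 2 * t / (1 + t ^+ 2).
have df (t : R) : is_derive t (1 : R) f (f' t).
  have h : is_derive t (1 : R) (fun t : R => 1 + t ^+ 2) (2 * t).
    by apply: is_derive_eq; rewrite add0r scaler1 mul1r -mulr2n mulr_natl.
  have := @is_derive1_comp R (@ln R) (fun t : R => 1 + t ^+ 2) t _ _
    (is_derive1_ln (p t)) h.
  by rewrite /f' mulrC.
(* The difference of the derivatives has the sign of (y - x) (1 - x y). The mean value theorem on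
   either side of [m] then gives the tangent bound. *)
have f'_le (x y : R) : 0 <= x -> x <= y -> y <= 1 -> f' x <= f' y.
  move=> x0 xy y1; rewrite /f' ler_pdivlMr ?p// mulrAC ler_pdivrMr ?p//.
  rewrite -subr_ge0.
  have -> : 2 * y * (1 + x ^+ 2) - 2 * x * (1 + y ^+ 2) =
    2 * ((y - x) * (1 - x * y)) by ring.
  have y0 := le_trans x0 xy; have x1 := le_trans xy y1.
  by rewrite !mulr_ge0 ?subr_ge0// mulr_ile1.
have cf (B : set R) : {within B, continuous f}.
  apply: continuous_subspaceT => t.
  apply/differentiable_continuous/derivable1_diffP.
  by case: (df t).
move=> /andP[m0 m1] /andP[v0 v1]; rewrite -/(f' m) -/(f v) -/(f m).
have [mv|/ltW vm] := leP m v.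
  have [c + ->] := MVT_segment mv (fun t _ => df t) (cf _).
  rewrite in_itv /= => /andP[mc cv].
  by rewrite ler_wpM2r ?subr_ge0// f'_le// (le_trans cv).
rewrite -lerN2 opprB -mulrN opprB.
have [c + ->] := MVT_segment vm (fun t _ => df t) (cf _).
rewrite in_itv /= => /andP[vc cm].
by rewrite ler_wpM2r ?subr_ge0// f'_le// (le_trans v0).
Qed.

Lemma ln_sqr_bound m v : 0 <= m <= 1 -> 0 <= v <= 1 ->
  (1 + m * v) / (1 + m ^+ 2) <= 1 + ln ((1 + v ^+ 2) / (1 + m ^+ 2)) / 2.
Proof.
have p (t : R) : 0 < 1 + t ^+ 2 by rewrite ltr_wpDr ?sqr_ge0.
move=> hm hv; rewrite ln_div ?posrE ?p//.
have -> : (1 + m * v) / (1 + m ^+ 2) =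
    1 + 2 * m / (1 + m ^+ 2) * (v - m) / 2 by field; rewrite gt_eqF.
by rewrite lerD2l ler_pM2r ?invr_gt0//; exact: ln_sqr_tangent.
Qed.

(** In the application <u, x> = 1, A = |x|^2 |u|^2, D = |y|^2 |u|^2, N = <x, y> |u|^2 and U = <u,
    y>. As exp z >= 1 + z and U <= 1, it is enough that N/A <= 1 + ln (D/A) / 2. With m^2 = A - 1
    and w^2 = D - U^2 one has N <= U + m w, and [ln_sqr_bound] applies with v = w if U = 1 and with
    v = 1 if D = 2. *)
Lemma support_bound_boundary A D N U s : 1 <= A <= 2 -> 0 < D <= 2 -> U <= 1 ->
  U ^+ 2 <= D -> (N - U) ^+ 2 <= (A - 1) * (D - U ^+ 2) -> 0 <= s <= 1 ->
  U = 1 \/ D = 2 ->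
  s * U + (1 - s) * (N / A) <= (D / A) `^ ((1 - s) / 2).
Proof.
move=> /andP[A1 A2] /andP[D0 D2] U1 UD gram /andP[s0 s1] UorD.
have A0 : 0 < A := lt_le_trans ltr01 A1.
suff NA : N / A <= 1 + ln (D / A) / 2.
  rewrite /powR gt_eqF ?divr_gt0//; apply: le_trans (expR_ge1Dx _).
  have := ler_wpM2l s0 U1; rewrite mulr1 => sU.
  have : 0 <= 1 - s by rewrite subr_ge0.
  by move=> /ler_wpM2l /(_ _ _ NA); lra.
pose m := Num.sqrt (A - 1); pose w := Num.sqrt (D - U ^+ 2).
have m0 : 0 <= m := sqrtr_ge0 _; have w0 : 0 <= w := sqrtr_ge0 _.
have m2 : m ^+ 2 = A - 1 by rewrite sqr_sqrtr// subr_ge0.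
have w2 : w ^+ 2 = D - U ^+ 2 by rewrite sqr_sqrtr// subr_ge0.
have m1 : m <= 1 by rewrite -(@ler_sqr _ m 1) ?nnegrE// m2; lra.
have Nle : N <= U + m * w.
  have : N - U <= m * w.
    have mw0 : 0 <= m * w by rewrite mulr_ge0.
    rewrite leNgt; apply/negP => h.
    have : (m * w) ^+ 2 < (N - U) ^+ 2.
      by rewrite ltr_sqr ?nnegrE// ltW// (le_lt_trans mw0).
    by rewrite exprMn m2 w2 ltNge gram.
  by lra.
have hm : 0 <= m <= 1 by rewrite m0 m1.
have Am : A = 1 + m ^+ 2 by rewrite m2; ring.
case: UorD => [U_1|D_2].
  have Dw : D = 1 + w ^+ 2 by rewrite w2 U_1; ring.
  have hw : 0 <= w <= 1.
    by rewrite w0 -(@ler_sqr _ w 1) ?nnegrE//= w2 U_1; lra.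
  apply: le_trans (_ : (1 + m * w) / A <= _).
    by rewrite ler_pM2r ?invr_gt0// -U_1.
  by rewrite Dw Am; exact: ln_sqr_bound.
apply: le_trans (_ : (1 + m * 1) / A <= _); last first.
  have := @ln_sqr_bound m 1 hm; rewrite ler01 lexx expr1n D_2 Am; exact.
rewrite ler_pM2r ?invr_gt0//; apply: le_trans Nle _.
have [w1|w1] := leP w 1; first by rewrite lerD// ler_wpM2l.
have Uw : U + w <= 2.
  have : (U + w) ^+ 2 <= 2 ^+ 2 by have := sqr_ge0 (U - w); nra.
  have [|Uw0] := leP (U + w) 0; first lra.
  by rewrite ler_sqr ?nnegrE// ltW.
by nra.
Qed.

(* Scaling the point up to the boundary of the half-space or of the ball
   strengthens the inequality. *)
Lemma support_bound A D N U s : 1 <= A <= 2 -> 0 < D <= 2 -> U <= 1 ->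
  U ^+ 2 <= D -> (N - U) ^+ 2 <= (A - 1) * (D - U ^+ 2) -> 0 <= s <= 1 ->
  s * U + (1 - s) * (N / A) <= (D / A) `^ ((1 - s) / 2).
Proof.
move=> hA /andP[D0 D2] U1 UD gram hs; have A0 : 0 < A by case/andP: hA; lra.
(* The largest admissible factor: 1/U if the half-space is met first, sqrt (2/D) otherwise. *)
have [k [k1 kU kD kb]] : exists k, [/\ 1 <= k, k * U <= 1, k ^+ 2 * D <= 2 &
    k * U = 1 \/ k ^+ 2 * D = 2].
  have [/andP[U0 DU]|h] := boolP ((0 < U) && (D <= 2 * U ^+ 2)).
    have kU : U^-1 * U = 1 by rewrite mulVf// gt_eqF.
    exists U^-1; split; [by rewrite invf_ge1|by rewrite kU| |by left].
    by rewrite exprVn mulrC ler_pdivrMr ?exprn_gt0.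
  have k2 : Num.sqrt (2 / D) ^+ 2 = 2 / D by rewrite sqr_sqrtr ?divr_ge0 ?ltW.
  have kD : Num.sqrt (2 / D) ^+ 2 * D = 2 by rewrite k2 divfK ?gt_eqF.
  have k0 := sqrtr_ge0 (2 / D).
  exists (Num.sqrt (2 / D)); split; [|  |by rewrite kD|by right].
    by rewrite -(@ler_sqr _ 1) ?nnegrE// k2 expr1n ler_pdivlMr// mul1r.
  have [U0|U0] := leP U 0; first by have := mulr_ge0_le0 k0 U0; lra.
  move: h; rewrite U0 /= -ltNge => h.
  rewrite -(@ler_sqr _ _ 1) ?nnegrE ?mulr_ge0 ?(ltW U0)// exprMn k2 expr1n.
  by rewrite mulrAC ler_pdivrMr// mul1r ltW.
have k0 : 0 < k := lt_le_trans ltr01 k1.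
have := @support_bound_boundary A (k ^+ 2 * D) (k * N) (k * U) s hA.
have k2 : 0 < k ^+ 2 by rewrite exprn_gt0.
have UD' : (k * U) ^+ 2 <= k ^+ 2 * D by rewrite exprMn ler_pM2l.
have gram' : (k * N - k * U) ^+ 2 <= (A - 1) * (k ^+ 2 * D - (k * U) ^+ 2).
  have -> : (k * N - k * U) ^+ 2 = k ^+ 2 * (N - U) ^+ 2 by ring.
  have -> : (A - 1) * (k ^+ 2 * D - (k * U) ^+ 2) =
    k ^+ 2 * ((A - 1) * (D - U ^+ 2)) by ring.
  by rewrite ler_pM2l.
rewrite mulr_gt0// kD kU => /(_ isT isT UD' gram' hs kb).
(* Scaling multiplies the left side by k and the right side only by k^(1-s) <= k. *)
have -> : s * (k * U) + (1 - s) * (k * N / A) =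
  k * (s * U + (1 - s) * (N / A)) by ring.
rewrite -mulrA powRM ?divr_ge0 ?(ltW A0) ?(ltW D0) ?(ltW k2)//.
rewrite -powR_mulrn ?(ltW k0)// -powRrM mulrC -ler_pdivlMr//.
move=> /le_trans; apply.
rewrite mulrAC ler_piMl ?powR_ge0// ler_pdivrMr// mul1r.
rewrite -[leRHS]powRr1 ?(ltW k0)// ler_powR// mulrCA mulfV// mulr1.
by case/andP: hs; lra.
Qed.

End SqrtTwo.

(** * Convexity of radial powers of nearly round bodies *)

Section RoundCores.
Variables (R : realType) (n : nat).
Implicit Types (x y u z : 'rV[R]_n) (K : set 'rV[R]_n) (a l s r : R).

(** This is Cauchy-Schwarz for the components of [x] and [y] orthogonal to [u], each scaled by
    |u|^2. *)
Lemma gram_ineq u x y : dot u x = 1 ->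
  (dot x y * dot u u - dot u y) ^+ 2 <=
  (dot x x * dot u u - 1) * (dot y y * dot u u - dot u y ^+ 2).
Proof.
move=> ux; set g := dot u u.
have g0 : 0 < g.
  rewrite lt_neqAle dot_ge0 andbT eq_sym dot_eq0; apply: contra_eq_neq ux => ->.
  by rewrite dot0l eq_sym oner_eq0.
have := sqr_dot_le (g *: x + (-1) *: u) (g *: y + (- dot u y) *: u).
rewrite !(dotDl, dotDr, dotZl, dotZr) (dotC x u) (dotC y u) ux -/g => h.
rewrite -(ler_pM2l (exprn_gt0 2 g0)).
apply: le_trans (le_trans h _); rewrite le_eqVlt; apply/orP; left;
  by apply/eqP; ring.
Qed.

(* The functional on the left supports, at [vpow s x], the image under [vpow s]
   of the half-space [dot u y <= 1]. *)
Lemma dot_vpow_le u x y s : dot u x = 1 -> dot x x * dot u u <= 2 ->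
  dot u y <= 1 -> dot y y * dot u u <= 2 -> 0 <= s <= 1 ->
  dot (s *: u + ((1 - s) / dot x x) *: x) (vpow s y) <= enorm x `^ (s - 1).
Proof.
move=> ux xu uy yu hs; have [->|y0] := eqVneq y 0.
  by rewrite vpow0r dot0r powR_ge0.
have ne z : dot u z = 1 -> z != 0 /\ u != 0.
  move=> h; split; apply: contra_eq_neq h => ->;
  by rewrite ?dot0l ?dot0r eq_sym oner_eq0.
have [x0 u0] := ne _ ux.
have pos z : z != 0 -> 0 < dot z z.
  by rewrite -enorm_sqr exprn_even_gt0//= enorm_eq0.
have [[xx yy] uu] := (pos _ x0, pos _ y0, pos _ u0).
have A1 : 1 <= dot x x * dot u u.
  by have := sqr_dot_le u x; rewrite ux expr1n mulrC.
have := @support_bound R (dot x x * dot u u) (dot y y * dot u u)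
  (dot x y * dot u u) (dot u y) s.
rewrite A1 xu yu mulr_gt0//= uy => /(_ isT isT isT).
have -> : dot u y ^+ 2 <= dot y y * dot u u by rewrite mulrC sqr_dot_le.
move=> /(_ isT (gram_ineq y ux) hs).
have -> : dot x y * dot u u / (dot x x * dot u u) = dot x y / dot x x.
  by field; rewrite !gt_eqF.
have -> : dot y y * dot u u / (dot x x * dot u u) = (enorm y / enorm x) ^+ 2.
  by rewrite expr_div_n !enorm_sqr; field; rewrite !gt_eqF.
rewrite -powR_mulrn ?divr_ge0 ?enorm_ge0// -powRrM.
have -> : 2%:R * ((1 - s) / 2) = - (s - 1) by field.
rewrite dotZr dotDl !dotZl => h.
have ey : 0 < enorm y `^ (s - 1) by rewrite powR_gt0 ?enorm_gt0.
apply: le_trans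
  (_ : enorm y `^ (s - 1) * (enorm y / enorm x) `^ (- (s - 1)) <= _).
  rewrite ler_pM2l//; apply: le_trans h.
  by rewrite mulrAC mulrA.
rewrite powRM ?invr_ge0 ?enorm_ge0// powRinv ?enorm_ge0// !powRN invrK.
by rewrite mulrA mulfV ?mul1r// gt_eqF.
Qed.

(** Suppose a half-space <u, y> <= c contains [K] but not the preimage [x] of [z]. Then x = t x0
    with t > 1 and x0 on the bounding hyperplane. The functional of [dot_vpow_le] at x0 bounds the
    image of [K] by its value at [vpow s x0], and z = t^s [vpow s x0] exceeds this value. *)
Lemma hull_closed_vpow a s K : 0 < a -> hull_closed K -> eball 0 a `<=` K ->
  K `<=` eball 0 (Num.sqrt 2 * a) -> 0 < s <= 1 ->
  hull_closed (vpow s @` K).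
Proof.
move=> a0 hK aK Ka /andP[s0 s1] z hz.
pose x := vpow s^-1 z.
have xz : vpow s x = z by rewrite vpow_comp mulfV ?gt_eqF// vpow1.
exists x => //; apply: hK => u c hc.
rewrite leNgt; apply/negP => cu.
have u0 : u != 0.
  apply: contraTneq cu => u0; rewrite u0 dot0l -leNgt.
  by have := hc 0; rewrite dot0r; apply; apply/aK/eball0P; rewrite enorm0 ltW.
have eu : 0 < enorm u by rewrite enorm_gt0.
have ac : a * enorm u <= c.
  have := hc ((a / enorm u) *: u).
  rewrite dotZr -enorm_sqr expr2 mulrA divfK ?gt_eqF//.
  apply; apply/aK/eball0P; rewrite enormZ gtr0_norm ?divr_gt0//.
  by rewrite divfK ?gt_eqF.
have c0 : 0 < c by apply: lt_le_trans ac; rewrite mulr_gt0.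
pose t := dot u x / c.
have t1 : 1 < t by rewrite ltr_pdivlMr// mul1r.
have t0 : 0 < t := lt_trans ltr01 t1.
have sa0 : 0 < Num.sqrt 2 * a by rewrite mulr_gt0 ?sqrtr_gt0.
(* The inner ball gives a |u| <= c, so |y| |u| / c <= sqrt 2. *)
have bound y : enorm y <= Num.sqrt 2 * a ->
    dot y y * dot (c^-1 *: u) (c^-1 *: u) <= 2.
  move=> ya; rewrite -!enorm_sqr -exprMn -(sqr_sqrtr (ltW (ltr0n R 2))).
  rewrite ler_sqr ?nnegrE ?mulr_ge0 ?enorm_ge0 ?sqrtr_ge0//.
  rewrite enormZ gtr0_norm ?invr_gt0// mulrCA mulrC ler_pdivrMr//.
  apply: le_trans (_ : Num.sqrt 2 * a * enorm u <= _).
    by rewrite ler_pM2r.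
  by rewrite -mulrA ler_pM2l ?sqrtr_gt0.
have xa : enorm x <= Num.sqrt 2 * a.
  have [z0|z0] := eqVneq z 0; first by rewrite /x z0 vpow0r enorm0 ltW.
  have /eball0P za : eball 0 ((Num.sqrt 2 * a) `^ s) z.
    apply: hull_closed_eball; first exact: powR_ge0.
    move=> v d hd; apply: hz => _ [y Ky <-]; apply: hd; apply/eball0P.
    apply: le_trans (enorm_vpow_le _ _) _.
    rewrite ge0_ler_powR ?nnegrE ?enorm_ge0 ?(ltW s0) ?(ltW sa0)//.
    exact/eball0P/Ka.
  rewrite enorm_vpow//.
  apply: le_trans (_ : ((Num.sqrt 2 * a) `^ s) `^ s^-1 <= _).
    by rewrite ge0_ler_powR ?nnegrE ?enorm_ge0 ?powR_ge0 ?invr_ge0 ?(ltW s0).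
  by rewrite -powRrM mulfV ?gt_eqF// powRr1// ltW.
pose x0 := t^-1 *: x.
have ux0 : dot (c^-1 *: u) x0 = 1.
  by rewrite dotZl dotZr /t; field; rewrite !gt_eqF// (lt_trans c0).
have x0_neq0 : x0 != 0.
  by apply: contra_eq_neq ux0 => ->; rewrite dot0r eq_sym oner_eq0.
have x0a : enorm x0 <= Num.sqrt 2 * a.
  rewrite enormZ gtr0_norm ?invr_gt0// mulrC ler_pdivrMr//.
  by apply: le_trans xa _; rewrite ler_peMr// ltW.
have : dot (s *: (c^-1 *: u) + ((1 - s) / dot x0 x0) *: x0) z <=
    enorm x0 `^ (s - 1).
  apply: hz => _ [y Ky <-]; apply: dot_vpow_le => //.
  - exact: bound.
  - by rewrite dotZl mulrC ler_pdivrMr// mul1r hc.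
  - exact/bound/eball0P/Ka.
  - by rewrite ltW.
have -> : z = t `^ s *: vpow s x0.
  by rewrite -vpowZ// scalerA mulfV ?scale1r// gt_eqF.
rewrite dotZr /vpow dotZr dotDl (dotZl s) ux0 dotZl divfK ?dot_eq0//.
rewrite mulr1 (addrC s (1 - s)) subrK mulr1 leNgt => /negP; apply.
rewrite ltr_pMl ?powR_gt0 ?enorm_gt0//.
by rewrite -(powRr0 t) /powR gt_eqF// ltr_expR ltr_pM2r ?ln_gt0.
Qed.

Lemma core_power_inv a l r K : body r K -> 0 < a -> eball 0 a `<=` K ->
  K `<=` eball 0 (Num.sqrt 2 * a) -> 0 < l <= 1 ->
  core_power l^-1 (core_power l K) = K.
Proof.
move=> bK a0 aK Ka /andP[l0 l1]; have [_ hK _ _] := bK.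
have hl : side true l by rewrite /side (ltW l0).
have hl' : side false l^-1 by rewrite /side invf_ge1.
have hvpow s := @hull_closed_vpow a s K a0 hK aK Ka.
have KE : core_power l K = vpow l @` K.
  rewrite (core_powerE bK hl); apply/seteqP; split; last first.
    by move=> _ [x Kx <-]; exact: vpow_power.
  (* At time 0 the whole space is taken, as [hull_closed_vpow] covers positive exponents. *)
  pose X s := [set x | s = 0 \/ (vpow s @` K) x].
  have XE : evolution true K X.
    split=> [x Kx|s /andP[s0 s1] x hx|s t x /= _ _ [->|[y Ky <-]]].
    - by right; exists x => //; rewrite vpow1.
    - have [->|sn0] := eqVneq s 0; first by left.
      right; apply: hvpow; first by rewrite lt_neqAle eq_sym sn0 s0.
      move=> u c hc; apply: hx => y [/eqP|]; first by rewrite (negbTE sn0).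
      exact: hc.
    - by left; rewrite mulr0.
    - by right; exists y => //; rewrite vpow_comp.
  move=> x /(power_min XE)[/eqP|//]; by rewrite gt_eqF.
have bK' := body_core_power (ltW l0) bK; rewrite KE in bK' *.
rewrite (core_powerE bK' hl'); apply/seteqP; split=> x.
  (* The images run backwards up to time 1/l, where they return to [K]; beyond it the family is the
     whole space. *)
  pose X s := [set x | s * l <= 1 -> (vpow (s * l) @` K) x].
  have XE : evolution false (vpow l @` K) X.
    split=> [y Ky|s s1 y hy sl|s t y /= s1 t1 Xy tsl].
    - by rewrite /X /= mul1r.
    - have s0 : 0 < s by exact: lt_le_trans s1.
      apply: hvpow; first by rewrite mulr_gt0.
      by move=> u c hc; apply: hy => w /(_ sl) /hc.
    - have s0 : 0 < s by exact: lt_le_trans s1.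
      have sl : s * l <= 1.
        apply: le_trans tsl; rewrite -mulrA ler_peMl// mulr_ge0 ?ltW//.
      by have [w Kw <-] := Xy sl; exists w => //; rewrite vpow_comp mulrA.
  move=> /(power_min XE); rewrite /X /= mulVf ?gt_eqF//.
  move=> /(_ (lexx _)) [y Ky <-].
  by rewrite vpow1.
move=> Kx; rewrite -(vpow1 x) -(@mulVf _ l) ?gt_eqF// -vpow_comp.
by apply: vpow_power => //; exists x.
Qed.

End RoundCores.

(** * Powers of flowers, defined through their cores *)

Section FlowerPowers.
Variables (R : realType) (n : nat).
Implicit Types (K F G : set 'rV[R]_n) (a c e l m r s t : R).

Definition fpower l F : set 'rV[R]_n := flower (core_power l (core F)).

Lemma core_fpower l r F : 0 <= l -> body r (core F) ->
  core (fpower l F) = core_power l (core F).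
Proof.
move=> l0 bF; have bP := body_core_power l0 bF.
by apply: core_flower (body0 bP); case: bP.
Qed.

Lemma fpower_mono l F1 F2 : F1 `<=` F2 -> fpower l F1 `<=` fpower l F2.
Proof.
by move=> F12; apply: flower_mono; apply: power_mono; exact: core_mono.
Qed.

Lemma fpower_dilate l t F : 0 < t ->
  fpower l (dilate t F) = dilate (t `^ l) (fpower l F).
Proof.
move=> t0; rewrite /fpower dilate_core// /core_power power_dilate//.
by rewrite dilate_flower// powR_gt0.
Qed.

(** Since r^0 = 1, the inner and outer balls of the core power coincide. *)
Lemma fpower0 F : flowers R n F -> fpower 0 F = unit_eball R n.
Proof.
move=> /flowers_body[r bF]; have := body_core_power (lexx 0) bF.
rewrite powRr0 => -[_ _ lower upper]; apply/seteqP; split=> [y [x Px xy]|y].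
  apply/eball0P; apply: le_trans (petal_le_enorm xy) _.
  exact/eball0P/upper.
by move=> y1; apply: sub_flower; apply: lower; rewrite invr1.
Qed.

Lemma fpower1 F : flowers R n F -> fpower 1 F = F.
Proof.
move=> FF; have [r bF] := flowers_body FF.
by rewrite /fpower /core_power (power_one _ bF) flower_core//; case: FF.
Qed.

Lemma fpower_lipschitz l m r F : 0 <= l -> 0 <= m -> body r (core F) ->
  fpower l F `<=` dilate (r `^ `|l - m|) (fpower m F).
Proof.
move=> l0 m0 bF; have [r1 _ _ _] := bF.
have r0 : 0 < r := lt_le_trans ltr01 r1.
rewrite -dilate_flower ?powR_gt0//.
exact: flower_mono (core_power_lipschitz l0 m0 bF).
Qed.

(** Each petal is star-shaped about the origin, hence so is a flower. *)
Lemma dilate_fpower_le a c l F : 0 <= a -> a <= c -> 0 < c ->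
  dilate a (fpower l F) `<=` dilate c (fpower l F).
Proof.
move=> a0 ac c0 _ [y [x Px /petalE xy] <-]; exists ((a / c) *: y); last first.
  by rewrite scalerA mulrC divfK// gt_eqF.
exists x => //; apply/petalE; rewrite !(dotZl, dotZr).
rewrite ler_wpM2l ?divr_ge0 ?(ltW c0)//; apply: le_trans xy.
by rewrite ler_piMl ?dot_ge0// ler_pdivrMr// mul1r.
Qed.

Lemma fpower_continuous (Fs : nat -> set 'rV[R]_n) F (ls : nat -> R) l :
  flowers R n F -> (forall i, 0 <= ls i) -> 0 <= l ->
  flower_cvg Fs F -> ls @ \oo --> l ->
  flower_cvg (fun i => fpower (ls i) (Fs i)) (fpower l F).
Proof.
move=> FF ls0 l0 [eps eps0 FsF] lsl; have [r bF] := flowers_body FF.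
have [r1 _ _ _] := bF; have r0 : 0 < r := lt_le_trans ltr01 r1.
(* The logarithm of the total distortion: the first term comes from the change of exponent, the
   second from the change of flower by homogeneity. Both logarithms enter so that [q] serves both
   inclusions. *)
pose q i := `|ls i - l| * ln r + ls i * (`|ln (1 + eps i)| + `|ln (1 - eps i)|).
have q0 : q @ \oo --> 0.
  have -> : 0 = `|l - l| * ln r + l * (`|ln (1 + 0)| + `|ln (1 - 0)|) :> R.
    by rewrite subrr addr0 subr0 ln1 normr0 addr0 mul0r mulr0 addr0.
  have ln_cvg (u : nat -> R) :
      u @ \oo --> (1 : R) -> ln (u i) @[i --> \oo] --> ln (1 : R).
    by move=> u1; apply: continuous_cvg u1; exact: continuous_ln.
  apply: cvgD; apply: cvgM => //.
  - by apply: cvg_norm; apply: cvgB => //; exact: cvg_cst.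
  - exact: cvg_cst.
  - apply: cvgD; apply: cvg_norm.
    + rewrite [in X in _ --> X]addr0; apply: ln_cvg.
      by rewrite -[X in _ --> X]addr0; apply: cvgD => //; exact: cvg_cst.
    + rewrite [in X in _ --> X]subr0; apply: ln_cvg.
      by rewrite -[X in _ --> X]subr0; apply: cvgB => //; exact: cvg_cst.
have c1 : expR (q i) @[i --> \oo] --> (1 : R).
  by rewrite -expR0; apply: continuous_cvg q0; exact: continuous_expR.
(* The upper factor is then exactly exp q. The lower one, 2 - exp q, is at most exp (-q), and it is
   positive once exp q < 2. *)
exists (fun i => expR (q i) - 1).
  by rewrite -(subrr 1); apply: cvgB => //; exact: cvg_cst.
have eps_lt : \forall i \near \oo, `|eps i| < 1.
  by have /cvgr0Pnorm_lt := eps0; apply.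
have c_lt : \forall i \near \oo, expR (q i) < 2.
  by apply: (c1 [set z | z < 2]); apply: lt_nbhsl; rewrite ltr1n.
near=> i.
have [lo up] : dilate (1 - eps i) F `<=` Fs i /\ Fs i `<=` dilate (1 + eps i) F.
  by near: i; exact: FsF.
have : `|eps i| < 1 by near: i.
rewrite ltr_norml => /andP[e1 e2].
have c2 : expR (q i) < 2 by near: i.
have p0 : 0 < 1 + eps i by lra.
have m0 : 0 < 1 - eps i by lra.
have rE : r `^ `|ls i - l| = expR (`|ls i - l| * ln r) by rewrite /powR gt_eqF.
split; last first.
  apply: subset_trans (@fpower_mono _ _ _ up) _; rewrite fpower_dilate//.
  have h := fpower_lipschitz (ls0 i) l0 bF.
  apply: subset_trans (dilate_mono h) _.
  rewrite dilate_comp (addrC 1 (_ - 1)) subrK; apply: dilate_fpower_le.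
  - by rewrite mulr_ge0 ?powR_ge0.
  - rewrite rE /powR gt_eqF// -expRD ler_expR addrC lerD2l ler_wpM2l//.
    by apply: le_trans (ler_norm _) _; rewrite lerDl.
  - exact: expR_gt0.
apply: subset_trans _ (@fpower_mono _ _ _ lo); rewrite fpower_dilate//.
have := dilate_mono (c := expR (- q i)) (fpower_lipschitz l0 (ls0 i) bF).
rewrite dilate_comp => h.
apply: subset_trans (_ : dilate (expR (- q i)) (fpower l F) `<=` _).
  apply: dilate_fpower_le; [lra| |exact: expR_gt0].
  rewrite expRN -(ler_pM2r (expR_gt0 (q i))) mulVf ?gt_eqF ?expR_gt0//.
  by have := sqr_ge0 (expR (q i) - 1); nra.
apply: subset_trans h _; apply: dilate_fpower_le.
- by rewrite mulr_ge0 ?expR_ge0 ?powR_ge0.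
- rewrite distrC rE /powR gt_eqF// -expRD ler_expR.
  have h : - (`|ln (1 + eps i)| + `|ln (1 - eps i)|) <= ln (1 - eps i).
    rewrite lerNl; apply: le_trans (_ : `|ln (1 - eps i)| <= _).
      by rewrite -normrN ler_norm.
    by rewrite lerDr.
  by have := ler_wpM2l (ls0 i) h; rewrite /q; lra.
- exact: powR_gt0.
Unshelve. all: by end_near. Qed.

End FlowerPowers.

Theorem theorem3p1 (R : realType) (n : nat) :
  exists pw : R -> set 'rV[R]_n -> set 'rV[R]_n,
    (forall (l : R) (F : set 'rV[R]_n),
        0 <= l -> flowers R n F -> flowers R n (pw l F))
    /\ (forall F : set 'rV[R]_n, flowers R n F ->
        pw 1 F = F /\ pw 0 F = unit_eball R n)
    /\ (forall (l : R) (F1 F2 : set 'rV[R]_n),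
        0 <= l -> flowers R n F1 -> flowers R n F2 ->
        F1 `<=` F2 -> pw l F1 `<=` pw l F2)
    /\ (forall (l t : R) (F : set 'rV[R]_n),
        0 <= l -> 0 < t -> flowers R n F ->
        pw l (dilate t F) = dilate (t `^ l) (pw l F))
    /\ (forall (Fs : nat -> set 'rV[R]_n) (F : set 'rV[R]_n)
            (ls : nat -> R) (l : R),
        (forall i, flowers R n (Fs i)) -> flowers R n F ->
        (forall i, 0 <= ls i) -> 0 <= l ->
        flower_cvg Fs F -> ls @ \oo --> l ->
        flower_cvg (fun i => pw (ls i) (Fs i)) (pw l F))
    /\ (forall (l m : R) (F : set 'rV[R]_n), flowers R n F ->
        (0 < l <= 1 /\ 0 < m <= 1) \/ (1 <= l /\ 1 <= m) ->
        pw l (pw m F) = pw (l * m) F)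
    /\ (forall (F : set 'rV[R]_n) (a : R), flowers R n F -> 0 < a ->
        dilate a (unit_eball R n) `<=` F ->
        F `<=` dilate (Num.sqrt 2 * a) (unit_eball R n) ->
        forall l : R, 0 < l <= 1 -> pw l^-1 (pw l F) = F).
Proof.
exists (@fpower R n); do ?apply: conj.
- move=> l F l0 /flowers_body[r bF].
  exact: flowers_flower (body_core_power l0 bF).
- by move=> F FF; split; [exact: fpower1|exact: fpower0].
- by move=> l F1 F2 _ _ _; exact: fpower_mono.
- by move=> l t F _ t0 _; exact: fpower_dilate.
- by move=> Fs F ls l _; exact: fpower_continuous.
- move=> l m F /flowers_body[r bF] hlm.
  have m0 : 0 <= m.
    case: hlm => [[_ /andP[/ltW//]]|[_]]; exact: le_trans.
  by rewrite {1}/fpower (core_fpower m0 bF) (core_power_power bF hlm).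
- move=> F a FF a0 lower upper l hl; have [r bF] := flowers_body FF.
  have l0 : 0 <= l by case/andP: hl => /ltW.
  rewrite {1}/fpower (core_fpower l0 bF) (core_power_inv bF a0)//.
  + by rewrite flower_core//; case: FF.
  (* A ball about 0 contains the petals of its points, so the core of [F] contains every such ball
     inside [F]. *)
  + move=> x /eball0P xa y xy; apply: lower; rewrite dilate_unit_eball//.
    exact/eball0P/(le_trans (petal_le_enorm xy)).
  + rewrite -dilate_unit_eball ?mulr_gt0 ?sqrtr_gt0//.
    exact: subset_trans (@core_sub _ _ F) upper.
Qed.
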